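(* Let $\{(X_t,c_t):t\in T\}$ be a family of pairwise disjoint fuzzy closure spaces. The sum $(X,c)=\big(\bigcup_{t\in T}X_t,\oplus c_t\big)$ is ČF-normal if and only if each $(X_t,c_t)$ is ČF-normal.
   Context: $I=[0,1]$; a fuzzy (sub)set of a non-empty set $X$ is a map $f:X\to I$, and $I^X$ is the set of all of them, ordered pointwise, with $\vee,\wedge$ pointwise supremum/infimum. $\underline 0$ is the constant $0$ fuzzy set (the empty fuzzy set); $1_A$ is the characteristic function of $A\subseteq X$; the complement is $\mathfrak{Co}(f)(x)=1-f(x)$. A fuzzy closure space is a pair $(X,c)$ with $X$ a non-empty set and $c:I^X\to I^X$ satisfying $c(\underline 0)=\underline 0$, $f\le c(f)$, and $c(f\vee g)=c(f)\vee c(g)$ for all $f,g\in I^X$ (idempotency is not required). Sum: if the sets $X_t$ are pairwise disjoint, $X=\bigcup_{t\in T}X_t$ and $\oplus c_t(f)=\bigvee_{t\in T}c_t(1_{X_t}\wedge f)$ for $f\in I^X$, where $1_{X_t}\wedge f$ is regarded as a fuzzy subset of $X_t$ and $c_t(\cdot)\in I^{X_t}$ is extended by $0$ to $X$. The interior is $\operatorname{int}(f)=\mathfrak{Co}(c(\mathfrak{Co}(f)))$; $f$ is a neighborhood of a fuzzy set $k$ if $k\le\operatorname{int}(f)$. $(X,c)$ is ČF-normal if for all non-empty fuzzy sets $k_1,k_2\in I^X$ with $c(k_1)\le\mathfrak{Co}(c(k_2))$ there are neighborhoods $f_1$ of $k_1$ and $f_2$ of $k_2$ with $f_1\le\mathfrak{Co}(f_2)$.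 *)

(* Defs.v *)
From HB Require Import structures.
From mathcomp Require Import all_boot all_order all_algebra.
From mathcomp Require Import interval_inference boolp classical_sets functions reals.
Set Implicit Arguments.
Unset Strict Implicit.
Unset Printing Implicit Defensive.
Import Order.TTheory GRing.Theory Num.Theory.
Local Open Scope classical_set_scope.
Local Open Scope ring_scope.

(* The order [<=%O], the join [`|`%O] and the meet [`&`%O] on [fuzzy R X] are
   the pointwise ones that function types inherit from [{i01 R}]. *)
Definition fuzzy (R : realType) (X : Type) : Type := X -> {i01 R}.

Section FuzzySets.
Context {R : realType} {X : Type}.

Definition fuzzy0 : fuzzy R X := fun=> 0%:i01.

Definition fuzzy_char (A : set X) : fuzzy R X :=
  fun x => if x \in A then 1%:i01 else 0%:i01.

Definition fuzzyC (f : fuzzy R X) : fuzzy R X := fun x => (1 - (f x)%:num)%:i01.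

Section Supremum.
Variables (J : Type) (F : J -> fuzzy R X).

Let vals x : set R := range (fun j => (F j x)%:num).

Let vals_ub x : ubound (vals x) 1.
Proof. by move=> _ [j _ <-]. Qed.

Lemma fuzzy_sup_ge0 x : 0 <= sup (vals x).
Proof.
have [[v vx]|v] := pselect (vals x !=set0); last first.
  by rewrite sup_out // => -[].
apply: (@le_trans _ _ v); first by case: vx => j _ <-.
by apply: ub_le_sup => //; exists 1.
Qed.

Lemma fuzzy_sup_le1 x : sup (vals x) <= 1.
Proof.
have [v|v] := pselect (vals x !=set0); first exact: ge_sup.
by rewrite sup_out // => -[].
Qed.

(* The empty supremum is [fuzzy0], since [sup set0 = 0]. *)
Definition fuzzy_sup : fuzzy R X :=
  fun x => Itv01 (fuzzy_sup_ge0 x) (fuzzy_sup_le1 x).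

End Supremum.

Record is_fuzzy_closure (c : fuzzy R X -> fuzzy R X) : Prop := IsFuzzyClosure {
  fuzzy_closure_inhabited : inhabited X ;
  fuzzy_closure0 : c fuzzy0 = fuzzy0 ;
  fuzzy_closure_ext : forall f, (f <= c f)%O ;
  fuzzy_closureU : forall f g, c (f `|` g)%O = (c f `|` c g)%O }.

Definition fuzzy_int (c : fuzzy R X -> fuzzy R X) (f : fuzzy R X) : fuzzy R X :=
  fuzzyC (c (fuzzyC f)).

Definition fuzzy_nbhs (c : fuzzy R X -> fuzzy R X) (k f : fuzzy R X) : Prop :=
  (k <= fuzzy_int c f)%O.

Definition CF_normal (c : fuzzy R X -> fuzzy R X) : Prop :=
  forall k1 k2 : fuzzy R X, k1 <> fuzzy0 -> k2 <> fuzzy0 ->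
    (c k1 <= fuzzyC (c k2))%O ->
    exists f1 f2 : fuzzy R X,
      [/\ fuzzy_nbhs c k1 f1, fuzzy_nbhs c k2 f2 & (f1 <= fuzzyC f2)%O].

End FuzzySets.

Section Subsets.
Context {R : realType} {U : Type} {A B : set U}.

Definition fuzzy_restr (AB : A `<=` B) (f : fuzzy R B) : fuzzy R A :=
  f \o subfun AB.

Definition fuzzy_ext0 (g : fuzzy R A) : fuzzy R B :=
  valL_ 0%:i01 g \o set_val.

End Subsets.

Section Sum.
Context {R : realType} {U T : Type} {X : T -> set U}.
Variable c : forall t, fuzzy R (X t) -> fuzzy R (X t).

Let S : set U := \bigcup_t X t.

Lemma summand_subset t : X t `<=` S.
Proof. exact: bigcup_sup. Qed.

Definition sum_closure (f : fuzzy R S) : fuzzy R S :=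
  fuzzy_sup (fun t =>
    fuzzy_ext0 (c (fuzzy_restr (@summand_subset t) (fuzzy_char (set_val @^-1` X t) `&` f)%O))).

End Sum.

(* Main.v *)
(** Under disjointness the closure of the sum commutes with restriction to each
    summand, and the order, the complement and hence the interior are all tested
    summandwise. So a separation in the sum restricts to separations in the
    summands, and separations in the summands glue to one in the sum. A summand
    on which one of the two fuzzy sets vanishes is not covered by its own
    normality, but there the neighborhoods can be taken to be constants 0 and 1. *)
Require Import Defs.
From HB Require Import structures.
From mathcomp Require Import all_boot all_order all_algebra.
From mathcomp Require Import interval_inference boolp classical_sets functions reals.
Local Open Scope classical_set_scope.
Import Order.TTheory GRing.Theory Num.Theory.
Local Open Scope ring_scope.

Section FuzzyComplement.
Context {R : realType} {X : Type}.
Implicit Types f g k : fuzzy R X.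

Lemma fuzzyCK : involutive (@fuzzyC R X).
Proof. by move=> f; apply/funext => x; apply/val_inj; rewrite /= subKr. Qed.

Lemma fuzzy_ge0 f : (fuzzy0 <= f)%O.
Proof. by apply/lefP => x; rewrite -num_le /=. Qed.

Lemma fuzzy_leC f : (f <= fuzzyC fuzzy0)%O.
Proof. by apply/lefP => x; rewrite -num_le /= subr0. Qed.

Lemma fuzzy_nbhs0 (c : fuzzy R X -> fuzzy R X) f : fuzzy_nbhs c fuzzy0 f.
Proof. exact: fuzzy_ge0. Qed.

Lemma fuzzy_nbhsT (c : fuzzy R X -> fuzzy R X) k :
  is_fuzzy_closure c -> fuzzy_nbhs c k (fuzzyC fuzzy0).
Proof.
move=> cc; rewrite /fuzzy_nbhs /fuzzy_int fuzzyCK (fuzzy_closure0 cc).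
exact: fuzzy_leC.
Qed.

(** The two neighborhoods are packed into one pair so that a single choice over all indices can
    later select both at once. *)
Lemma CF_normal_separation (c : fuzzy R X -> fuzzy R X) k1 k2 :
  is_fuzzy_closure c -> CF_normal c -> (c k1 <= fuzzyC (c k2))%O ->
  exists f : fuzzy R X * fuzzy R X,
    [/\ fuzzy_nbhs c k1 f.1, fuzzy_nbhs c k2 f.2 & (f.1 <= fuzzyC f.2)%O].
Proof.
move=> cc nc k12.
have [->|k1_neq0] := pselect (k1 = fuzzy0).
  exists (fuzzy0, fuzzyC fuzzy0); split; first exact: fuzzy_nbhs0.
  - exact: fuzzy_nbhsT.
  - exact: fuzzy_ge0.
have [->|k2_neq0] := pselect (k2 = fuzzy0).
  exists (fuzzyC fuzzy0, fuzzy0); split; first exact: fuzzy_nbhsT.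
  - exact: fuzzy_nbhs0.
  - exact: lexx.
by have [f1 [f2 f12]] := nc _ _ k1_neq0 k2_neq0 k12; exists (f1, f2).
Qed.

End FuzzyComplement.

Section Restriction.
Context {R : realType} {U : Type} {A B : set U}.
Variable AB : A `<=` B.
Implicit Types f g : fuzzy R B.

Lemma fuzzy_restr_le f g :
  (f <= g)%O -> (fuzzy_restr AB f <= fuzzy_restr AB g)%O.
Proof. by move=> /lefP fg; apply/lefP => x; exact: fg. Qed.

(** The characteristic function takes the largest value, 1, on [A], so the truncation built into
    [sum_closure] disappears after restriction. *)
Lemma fuzzy_restr_char_meet f :
  fuzzy_restr AB (fuzzy_char (set_val @^-1` A) `&` f)%O = fuzzy_restr AB f.
Proof.
apply/funext => x; rewrite /fuzzy_restr /= meetfE /fuzzy_char ifT; last first.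
  by rewrite inE; exact: (set_valP x).
by apply: meet_r; rewrite -num_le /=.
Qed.

End Restriction.

Section Extension.
Context {R : realType} {U : Type} {A B : set U}.

(** The points [x] and [a] live in different subtypes, so they are compared in [U]. *)
Lemma fuzzy_ext0_in (g : fuzzy R A) (x : B) (a : A) :
  set_val x = set_val a -> fuzzy_ext0 g x = g a.
Proof.
move=> xa; rewrite /fuzzy_ext0 /= xa.
exact: (congr1 (fun h => h a) (valLK 0%:i01 g)).
Qed.

Lemma fuzzy_ext0_out (g : fuzzy R A) (x : B) :
  ~ A (set_val x) -> fuzzy_ext0 g x = 0%:i01.
Proof.
by move=> Ax; rewrite /fuzzy_ext0 /= oinv_set_val insubN // notin_setE.
Qed.

End Extension.

Section Gluing.
Context {R : realType} {U T : Type} {X : T -> set U}.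
Hypothesis X_disj : trivIset setT X.

Local Notation S := (\bigcup_t X t).
Local Notation restr t := (fuzzy_restr (@summand_subset U T X t)).
Implicit Types f g : fuzzy R S.

(** [sum_closure] unfolds to such a gluing, so [fuzzy_glueK] serves both to compute the closure of
    the sum and to restrict the neighborhoods assembled from the summands. *)
Definition fuzzy_glue (g : forall t, fuzzy R (X t)) : fuzzy R S :=
  fuzzy_sup (fun t => fuzzy_ext0 (g t)).

Lemma summand_unique s t (x : X s) : X t (set_val x) -> s = t.
Proof.
move=> Xtx; apply: X_disj => //.
by exists (set_val x); split=> //; exact: (set_valP x).
Qed.

(** At a point of [X t], disjointness makes every term of index other than [t] vanish. Since values
    are nonnegative, the supremum is the term of index [t]. *)
Lemma fuzzy_glueK (g : forall t, fuzzy R (X t)) t :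
  restr t (fuzzy_glue g) = g t.
Proof.
apply/funext => x; apply/val_inj => /=.
set y := subfun _ x.
have gty : fuzzy_ext0 (g t) y = g t x by exact: fuzzy_ext0_in.
apply/le_anti/andP; split.
  apply: ge_sup; first by exists (g t x)%:num; exists t; rewrite ?gty.
  move=> _ [s _ <-]; have [ts|ts] := pselect (t = s).
    by case: s / ts; rewrite gty.
  by rewrite (fuzzy_ext0_out (g s)) /= => [|/(summand_unique t s x)].
apply: ub_le_sup; last by exists t; rewrite ?gty.
by exists 1 => _ [s _ <-].
Qed.

(** The summands cover [S], and a point of [S] is determined by its underlying element of [U]. *)
Lemma fuzzy_le_restr f g : (forall t, (restr t f <= restr t g)%O) -> (f <= g)%O.
Proof.
move=> fg; apply/lefP => x; have [t _ Xtx] := set_valP x.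
have /lefP/(_ (SigSub (mem_set Xtx))) := fg t.
by rewrite /fuzzy_restr /=; set y := subfun _ _; have -> : y = x by exact/val_inj.
Qed.

Lemma fuzzy_restr_ext0 t (k : fuzzy R (X t)) : restr t (fuzzy_ext0 k) = k.
Proof. by apply/funext => x; exact: fuzzy_ext0_in. Qed.

Lemma fuzzy_restr_ext0_neq s t (k : fuzzy R (X t)) :
  s <> t -> restr s (fuzzy_ext0 k) = fuzzy0.
Proof.
move=> st; apply/funext => x; apply: fuzzy_ext0_out.
by move/(summand_unique s t x).
Qed.

Section Closure.
Variable c : forall t, fuzzy R (X t) -> fuzzy R (X t).

Lemma sum_closure_restr f t : restr t (sum_closure c f) = c t (restr t f).
Proof.
by rewrite -[LHS]/(restr t (fuzzy_glue _)) fuzzy_glueK fuzzy_restr_char_meet.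
Qed.

Lemma fuzzy_int_restr f t :
  restr t (fuzzy_int (sum_closure c) f) = fuzzy_int (c t) (restr t f).
Proof. exact: (congr1 fuzzyC (sum_closure_restr (fuzzyC f) t)). Qed.

Lemma fuzzy_nbhs_restr f k :
  fuzzy_nbhs (sum_closure c) k f <->
  forall t, fuzzy_nbhs (c t) (restr t k) (restr t f).
Proof.
split=> [kf t|kf]; first by rewrite /fuzzy_nbhs -fuzzy_int_restr fuzzy_restr_le.
by apply: fuzzy_le_restr => t; rewrite fuzzy_int_restr; exact: kf.
Qed.

End Closure.
End Gluing.

Theorem theorem8p1 (R : realType) (U T : Type) (X : T -> set U)
    (c : forall t : T, fuzzy R (X t) -> fuzzy R (X t)) :
  trivIset setT X ->
  (forall t, is_fuzzy_closure (c t)) ->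
  CF_normal (sum_closure c) <-> forall t, CF_normal (c t).
Proof.
move=> X_disj cc; split=> [nS t k1 k2 k1_neq0 k2_neq0 k12|nc k1 k2 _ _ k12].
  have ext_neq0 (k : fuzzy R (X t)) :
      k <> fuzzy0 -> fuzzy_ext0 k <> fuzzy0 :> fuzzy R (\bigcup_t X t).
    by move=> k_neq0 k0; apply: k_neq0; rewrite -(fuzzy_restr_ext0 _ k) k0.
  have [|f1 [f2 [kf1 kf2 f12]]] :=
      nS _ _ (ext_neq0 _ k1_neq0) (ext_neq0 _ k2_neq0).
    (* On the summand [t] the inequality is the given one. On any other, both extensions restrict to
       [fuzzy0], which is its own closure. *)
    apply: fuzzy_le_restr => s.
    (* Complement and restriction commute by mere computation. *)
    rewrite -[leRHS]/(fuzzyC (fuzzy_restr _ _)) !sum_closure_restr //.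
    have [st|st] := pselect (t = s).
      by case: s / st; rewrite !fuzzy_restr_ext0.
    have ts : s <> t by move/esym.
    by rewrite !fuzzy_restr_ext0_neq // (fuzzy_closure0 (cc s)) fuzzy_ge0.
  exists (fuzzy_restr (@summand_subset _ _ _ t) f1),
         (fuzzy_restr (@summand_subset _ _ _ t) f2); split.
  - by move/fuzzy_nbhs_restr : kf1 => /(_ X_disj t); rewrite fuzzy_restr_ext0.
  - by move/fuzzy_nbhs_restr : kf2 => /(_ X_disj t); rewrite fuzzy_restr_ext0.
  - exact: (fuzzy_restr_le (@summand_subset _ _ _ t) _ _ f12).
have sep t : exists f : fuzzy R (X t) * fuzzy R (X t),
    [/\ fuzzy_nbhs (c t) (fuzzy_restr (@summand_subset _ _ _ t) k1) f.1,
        fuzzy_nbhs (c t) (fuzzy_restr (@summand_subset _ _ _ t) k2) f.2 &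
        (f.1 <= fuzzyC f.2)%O].
  (* Nonzero [k1] and [k2] may restrict to [fuzzy0] here, so [CF_normal] alone would not apply. *)
  apply: CF_normal_separation => //.
  have := fuzzy_restr_le (@summand_subset _ _ _ t) _ _ k12.
  by rewrite -[leRHS]/(fuzzyC (fuzzy_restr _ _)) !sum_closure_restr.
pose f t := projT1 (cid (sep t)).
have fP t := projT2 (cid (sep t)).
exists (fuzzy_glue (fun t => (f t).1)), (fuzzy_glue (fun t => (f t).2)); split.
- by apply/fuzzy_nbhs_restr => // t; rewrite fuzzy_glueK //; case: (fP t).
- by apply/fuzzy_nbhs_restr => // t; rewrite fuzzy_glueK //; case: (fP t).
- apply: fuzzy_le_restr => t; rewrite -[leRHS]/(fuzzyC (fuzzy_restr _ _)).
  by rewrite !fuzzy_glueK //; case: (fP t).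
Qed.
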